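(* Let $G$ be a finite group such that the difference subgroup graph $D(G)$ has at least one edge and the independence number of $D(G)$ is at most $3$. Then $G$ is supersolvable.
   Context: For a finite group $G$, the difference subgroup graph $D(G)$ is the undirected graph whose vertices are the non-trivial proper subgroups of $G$, with two distinct vertices $H$ and $K$ adjacent if and only if $\langle H,K\rangle = G$ and $HK\neq G$, where $HK=\{hk : h\in H,\ k\in K\}$. The independence number $\alpha(D(G))$ is the size of a largest set of pairwise non-adjacent vertices of $D(G)$. *)

(* Defs.v *)
From HB Require Import structures.
From mathcomp Require Import all_boot all_fingroup all_solvable.
Set Implicit Arguments.
Unset Strict Implicit.
Unset Printing Implicit Defensive.
Local Open Scope group_scope.

(* Graphs are given by a vertex set V in a finite type and a relation e, of
   which only the restriction to V matters. *)
Definition independent (T : finType) (V : {set T}) (e : rel T) (S : {set T}) :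
    bool :=
  (S \subset V) &&
  [forall x in S, forall y in S, (x != y) ==> ~~ e x y].

Definition independence_number (T : finType) (V : {set T}) (e : rel T) : nat :=
  \max_(S : {set T} | independent V e S) #|S|.

Definition diff_vertices (gT : finGroupType) (G : {group gT}) :
    {set {group gT}} :=
  [set H : {group gT} | (H :!=: 1) && (H \proper G)].

(* H * K is the product set, not the group (H * K)%G generated by it. *)
Definition diff_adj (gT : finGroupType) (G : {group gT}) : rel {group gT} :=
  fun H K => [&& H != K, H <*> K :==: G & H * K :!=: G].

(* A and B are both required to be normal in the whole group G, unlike in a
   subnormal series with cyclic factors, which only gives solvability. *)
Definition cyclic_factor (gT : finGroupType) (G A B : {set gT}) : bool :=
  [&& A \subset B, A <| G, B <| G & cyclic (B / A)].

Definition supersolvable (gT : finGroupType) (G : {group gT}) : Prop :=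
  exists2 s : seq {group gT},
    (cyclic_factor G).-series 1%G s & last 1%G s = G.

(* Main.v *)
Require Import Defs.
From mathcomp Require Import all_boot all_fingroup all_solvable.
From mathcomp Require Import ssralg.

(** Subgroups of a common proper subgroup are pairwise non-adjacent in [D(G)],
    and a non-cyclic group has at least four non-trivial subgroups; hence
    independence number at most 3 forces every proper subgroup of [G] to be
    cyclic.  If all Sylow subgroups of [G] are normal, [G] is nilpotent, and a
    maximal subgroup is cyclic and normal with cyclic quotient.  Otherwise let
    [S] be a non-normal Sylow subgroup.  Its normaliser is proper, hence
    abelian, and no two distinct elements of [S] are conjugate in [G]; so the
    transfer [G -> S] sends [x] in [S] to [x ^+ #|G : S|] and is not trivial.
    Its kernel is proper, hence cyclic, and the quotient embeds in [S].  In
    both cases [G] is metacyclic, hence supersolvable. *)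

Set Implicit Arguments.
Unset Strict Implicit.
Unset Printing Implicit Defensive.
Import FiniteModule.
Local Open Scope group_scope.

Lemma metacyclic_supersolvable (gT : finGroupType) (G : {group gT}) :
  metacyclic G -> supersolvable G.
Proof.
case/metacyclicP=> K [cycK nKG cycGK]; exists [:: K; G] => //=.
rewrite /cyclic_factor sub1G normal1 nKG normal_refl cycGK (normal_sub nKG) /=.
by rewrite andbT quotient_cyclic.
Qed.

(** Take [x] of maximal order and [y] outside [<[x]>]: if [x] lay in [<[y]>], maximality would force
    [<[x]> = <[y]>]. *)
Lemma noncyclic_incomparable (gT : finGroupType) (H : {group gT}) :
  ~~ cyclic H ->
  exists x y, [/\ x \in H, y \in H, x \notin <[y]> & y \notin <[x]>].
Proof.
move=> ncycH; case: (@arg_maxnP _ 1 [in H] order (group1 H)) => x Hx maxx.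
have /subsetPn[y Hy nxy]: ~~ (H \subset <[x]>).
  apply: contra ncycH => sHx; apply/cyclicP; exists x.
  by apply/eqP; rewrite eqEsubset sHx cycle_subG.
exists x, y; split=> //; apply: contra nxy; rewrite -cycle_subG => sxy.
suff /eqP->: <[x]> == <[y]> by apply: cycle_id.
by rewrite eqEcard sxy; apply: maxx.
Qed.

Lemma noncyclic_four_subgroups (gT : finGroupType) (H : {group gT}) :
  ~~ cyclic H -> 3 < #|[set K : {group gT} | (K :!=: 1) && (K \subset H)]|.
Proof.
move=> ncycH; have [x [y [Hx Hy nxy nyx]]] := noncyclic_incomparable ncycH.
have nxyx: x * y \notin <[x]> by rewrite groupMl ?cycle_id.
have nxyy: x * y \notin <[y]> by rewrite groupMr ?cycle_id.
have ncyc z : (<[z]>%G == H) = false.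
  by apply: contraNF ncycH => /eqP <-; apply: cycle_cyclic.
have neq z (K : {group gT}) : z \notin K -> (K == <[z]>%G) = false.
  by apply: contraNF => /eqP->; apply: cycle_id.
(* [x * y] lies in neither [<[x]>] nor [<[y]>], so the three cycles are distinct; none is [H], which
   is not cyclic. *)
pose s := [:: <[x]>%G; <[y]>%G; <[x * y]>%G; H].
have uniq_s : uniq s.
  by rewrite /= !inE !ncyc !orbF (neq y <[x]>%G) // !(neq (x * y)).
have n1 z (K : {group gT}) : z \notin K -> <[z]> != 1.
  by rewrite cycle_eq1; apply: contraNneq => ->; apply: group1.
rewrite -[3.+1]/(size s) -(card_uniqP uniq_s); apply/subset_leq_card/subsetP.
move=> K; rewrite !inE => /or4P[] /eqP-> /=.
- by rewrite cycle_subG Hx (n1 x <[y]>%G).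
- by rewrite cycle_subG Hy (n1 y <[x]>%G).
- by rewrite cycle_subG groupM // (n1 (x * y) <[y]>%G).
by rewrite subxx andbT; apply: contraNneq ncycH => ->; apply: cyclic1.
Qed.

Lemma proper_cyclic (gT : finGroupType) (G H : {group gT}) :
    independence_number (diff_vertices G) (diff_adj G) <= 3 ->
  H \proper G -> cyclic H.
Proof.
move=> alpha3 prH; apply: contraLR alpha3 => /noncyclic_four_subgroups.
set S := [set K | _] => S4; rewrite -ltnNge (leq_trans S4) //.
apply: (bigmax_sup S) => //; apply/andP; split.
  apply/subsetP=> K; rewrite !inE => /andP[-> sKH].
  exact: sub_proper_trans sKH prH.
apply/forall_inP=> K /[!inE] /andP[_ sKH].
apply/forall_inP=> L /[!inE] /andP[_ sLH].
apply/implyP=> _; apply/and3P=> -[_ /eqP defG _].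
by case/andP: prH => _ /negP[]; rewrite -defG join_subG sKH.
Qed.

(** Normal Sylow subgroups lie in the Fitting subgroup, and the Sylow subgroups generate [G]. *)
Lemma normal_Sylow_nilpotent (gT : finGroupType) (G : {group gT}) :
  (forall S : {group gT}, Sylow G S -> S <| G) -> nilpotent G.
Proof.
move=> nSG; apply: nilpotentS (Fitting_nil G).
rewrite -{1}(Sylow_gen G) gen_subG; apply/bigcupsP=> S sylS.
apply: Fitting_max (nSG S sylS) _.
by case/SylowP: sylS => p _ /pHall_pgroup/pgroup_nil.
Qed.

Lemma nilpotent_maximal_normal (gT : finGroupType) (G M : {group gT}) :
  nilpotent G -> maximal M G -> M <| G.
Proof.
move=> nilG maxM; have prM := maxgroupp maxM; have sMG := proper_sub prM.
rewrite /normal sMG /=; case/maxgroupP: maxM => _ maxM.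
apply: contraT => nMG; case/negP: (proper_subn prM).
rewrite (nilpotent_sub_norm nilG sMG) //.
rewrite (maxM 'N_G(M)%G) //= ?subsetI ?sMG ?normG //.
by rewrite properE subsetIl subsetI subxx.
Qed.

Section MinimalNonCyclic.

Variables (gT : finGroupType) (G : {group gT}).
Hypothesis cyclic_sub : forall H : {group gT}, H \proper G -> cyclic H.

Lemma nilpotent_metacyclic : nilpotent G -> metacyclic G.
Proof.
move=> nilG; have [G1 | [M maxM _]] := maximal_exists (sub1G G).
  by rewrite -G1 metacyclic1.
have prM := maxgroupp maxM; have nMG := nilpotent_maximal_normal nilG maxM.
apply/metacyclicP; exists M; split=> //; first exact: cyclic_sub.
have [x Gx nMx] := subsetPn (proper_subn prM).
(* [M] and [x] generate [G], so [G / M] is the image of [<[x]>]. *)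
rewrite -(mulg_normal_maximal nMG maxM (_ : <[x]> \subset G)) ?cycle_subG //.
by rewrite quotientMidl quotient_cyclic ?cycle_cyclic.
Qed.

Section NonNormalSylow.

Variables (p : nat) (S : {group gT}).
Hypotheses (sylS : p.-Sylow(G) S) (not_nSG : ~~ (S <| G)).

Let sSG : S \subset G := pHall_sub sylS.

Let cycS : cyclic S.
Proof.
apply: cyclic_sub; rewrite properEneq sSG andbT.
by apply: contraNneq not_nSG => ->; apply: normal_refl.
Qed.

(** The transfer is taken along the identity of [S], whose image must be abelian. *)
Let abelS : abelian (idm S @* S).
Proof. by rewrite morphim_idm ?cyclic_abelian. Qed.

(* If [a] is not central, its centraliser is cyclic and contains both [S] and
   [S :^ y^-1]; these have the same order, so they coincide. *)
Lemma Sylow_conj_fix a y : a \in S -> y \in G -> a ^ y \in S -> a ^ y = a.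
Proof.
move=> Sa Gy Say; have abS := cyclic_abelian cycS.
have [cGa | not_cGa] := boolP (G \subset 'C[a]).
  by rewrite conjgE -(cent1P (subsetP cGa y Gy)) mulKg.
have cycC: cyclic 'C_G[a].
  by apply: (@cyclic_sub 'C_G[a]%G); rewrite properE subsetIl subsetI subxx.
have sSC: S \subset 'C_G[a].
  by rewrite subsetI sSG sub_cent1 (subsetP abS).
have sSyC: S :^ y^-1 \subset 'C_G[a].
  rewrite subsetI sub_conjg invgK conjGid // sSG sub_conjg invgK -cent1J.
  by rewrite sub_cent1 (subsetP abS).
have nSy: y \in 'N(S).
  rewrite -groupV; apply/normP/eqP.
  by rewrite (eq_subG_cyclic cycC sSyC sSC) cardJg.
(* Both [a] and [y] lie in this normaliser, so they commute. *)
have abN: abelian 'N_G(S).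
  apply: cyclic_abelian; apply: (@cyclic_sub 'N_G(S)%G).
  rewrite properE subsetIl subsetI subxx /=.
  by apply: contra not_nSG; rewrite /normal sSG.
have Ny: y \in 'N_G(S) by rewrite inE Gy.
have Na: a \in 'N_G(S) by rewrite inE (subsetP sSG) ?(subsetP (normG S)).
by rewrite conjgE -(centsP abN y Ny a Na) mulKg.
Qed.

(** The transfer is a sum over the [<[x]>]-orbits on the cosets of [S]. An orbit of length [n] with
    representative [y] contributes [(x ^+ n) ^ y^-1], which lies in [S] and so equals [x ^+ n]; the
    lengths add up to [#|G : S|]. *)
Lemma transfer_Sylow x :
  x \in S -> transfer G abelS x = fmod abelS (x ^+ #|G : S|).
Proof.
move=> Sx; have Gx := subsetP sSG x Sx.
have trX := transversalP (rcosets_cycle_partition sSG Gx).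
rewrite (transfer_cycle_expansion sSG abelS Gx trX).
rewrite -(sum_index_rcosets_cycle sSG Gx trX).
have imS : x \in idm S @* S by rewrite morphim_idm.
rewrite fmodX // -GRing.sumrMnr.
apply: eq_bigr => y Xy; rewrite -fmodX //= /restrm /=; congr (fmod _ _).
have Gy : y \in G := subsetP (transversal_sub trX) y Xy.
apply: Sylow_conj_fix; rewrite ?groupX ?groupV //.
by rewrite conjgE invgK mulgA -mem_rcoset mulg_exp_card_rcosets.
Qed.

Lemma nonnormal_Sylow_metacyclic : metacyclic G.
Proof.
pose V := [morphism of transfer G abelS].
have nKG : 'ker V <| G := ker_normal V.
have cycI : cyclic (V @* G).
  apply: (@cyclicS _ (fmod_morphism abelS @* (idm S @* S))).
    apply/subsetP=> u _; rewrite -(fmvalK u).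
    by apply: mem_morphim; apply: fmodP.
  by rewrite !morphim_cyclic.
apply/metacyclicP; exists ('ker V)%G; split=> //; last first.
  by rewrite (isog_cyclic (first_isog V)).
apply: cyclic_sub; rewrite properE (normal_sub nKG) /=.
apply: contra not_nSG => sGK.
have coSI: coprime #|S| #|G : S|.
  by have [_ pS p'I] := and3P sylS; apply: pnat_coprime pS p'I.
have [x defS] := cyclicP cycS; have Sx : x \in S by rewrite defS cycle_id.
(* If the transfer is trivial, the generator [x] satisfies [x ^+ #|G : S| = 1], so [#|S|] divides an
   index coprime to it. *)
suff -> : S :=: 1 by apply: normal1.
have /mker/= := subsetP sGK x (subsetP sSG x Sx).
rewrite transfer_Sylow // => /(congr1 val); rewrite fmodK => [|/=].
  move/eqP; rewrite -order_dvdn orderE -defS => dvdS; apply/card1_trivg.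
  by apply/eqP; rewrite -dvdn1 -(eqP coSI) dvdn_gcd dvdnn.
by rewrite morphim_idm ?groupX.
Qed.

End NonNormalSylow.

Lemma minimal_noncyclic_metacyclic : metacyclic G.
Proof.
have [nSG | ] := boolP [forall S : {group gT}, Sylow G S ==> (S <| G)].
  apply/nilpotent_metacyclic/normal_Sylow_nilpotent => S.
  exact: implyP (forallP nSG S).
case/forallPn=> S; rewrite negb_imply => /andP[/SylowP[p _ sylS]].
exact: nonnormal_Sylow_metacyclic sylS.
Qed.

End MinimalNonCyclic.

Theorem theorem5p3 (gT : finGroupType) (G : {group gT})
    (has_edge : exists H K : {group gT},
       [/\ H \in diff_vertices G, K \in diff_vertices G & diff_adj G H K])
    (alpha_le3 :
       independence_number (diff_vertices G) (diff_adj G) <= 3) :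
  supersolvable G.
Proof.
apply/metacyclic_supersolvable/minimal_noncyclic_metacyclic => H.
exact: proper_cyclic.
Qed.
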